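(* Let $(M,\rho)$ be a complete metric space, let $(X,E_v)$ be a vertical rooted graph with $\mathcal J_1(x)\ne\emptyset$ for all $x\in X$, and let $\Phi$ be an index map on $(X,E_v)$ over $(M,\rho)$ with attractor $K$. Suppose that for some $b>0$, $\{\Phi(x)\}_{x\in X}$ is of exponential type-$(b)$ and satisfies condition $(S_b)$. Then the $AI_\infty$-graph $(X,E^{(\infty)})$ is hyperbolic, and the induced bijection $\kappa:\partial X\to K$ is Hölder continuous, i.e., there is a constant $C>0$ such that $$\rho(\kappa(\xi),\kappa(\eta))^{a/b}\le C\,\theta_a(\xi,\eta),\qquad\forall\ \xi,\eta\in\partial X.$$
   Context: A rooted graph $(X,E)$ is a countable vertex set $X$ with a symmetric edge set $E\subset X\times X\setminus\Delta$ ($\Delta$ the diagonal) that is locally finite and connected, with a fixed root $\vartheta\in X$. Let $d$ be the graph distance, $|x|:=d(\vartheta,x)$, $X_n=\{x:|x|=n\}$. $\mathcal J_m(x)$ is the set of $y$ with $|y|=|x|+m$ such that $x$ lies on some geodesic from $\vartheta$ to $y$. The graph is vertical if it has no edges $(x,y)$ with $|x|=|y|$. $\mathcal R_v$ denotes the set of rays $\mathbf x=[x_i]_{i\ge0}$ with $x_0=\vartheta$ and $x_{i+1}\in\mathcal J_1(x_i)$ for all $i$. The Gromov product is $(x|y)=\frac12(|x|+|y|-d(x,y))$; $(X,E)$ is hyperbolic if there is $\delta\ge0$ with $(x|y)\ge\min\{(x|z),(z|y)\}-\delta$ for all $x,y,z\in X$. Then for a fixed $a>0$ with $e^{\delta a}<\sqrt2$,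 the Gromov metric on $X$ is $\theta_a(x,y)=\inf\{\sum_{i=1}^n e^{-a(x_{i-1}|x_i)}: n\ge1,\ x=x_0,\dots,x_n=y\in X\}$ for $x\neq y$, $\theta_a(x,x)=0$; $\widehat X$ is the $\theta_a$-completion and $\partial X=\widehat X\setminus X$ the hyperbolic boundary with the extended metric $\theta_a$. Every ray in $\mathcal R_v$ is $\theta_a$-Cauchy and converges to a point of $\partial X$, and (for the graphs considered) every point of $\partial X$ is the limit of a ray in $\mathcal R_v$. Let $\mathcal C_M$ be the family of nonempty compact subsets of $M$. An index map on $(X,E_v)$ over $(M,\rho)$ is a map $\Phi:X\to\mathcal C_M$ with $\Phi(y)\subset\Phi(x)$ for all $x\in X$, $y\in\mathcal J_1(x)$, and such that $\bigcap_{i\ge0}\Phi(x_i)$ is a singleton for every $[x_i]_i\in\mathcal R_v$. Its attractor is $K=\bigcap_{n\ge0}\bigcup_{x\in X_n}\Phi(x)$, and $K_x:=\Phi(x)\cap K$. It is of exponential type-$(b)$ if $|\Phi(x)|_\rho=O(e^{-b|x|})$ as $|x|\to\infty$ ($|\cdot|_\rho$ = diameter). Condition $(S_b)$: for any $c>0$ there is a constant $\bar\ell=\bar\ell(c)$ such that $\#\{x\in X_n:K_x\cap F\ne\emptyset\}\le\bar\ell$ for all $n\ge0$ and all $F\subset M$ with $|F|_\rho<ce^{-bn}$. Put $\{\kappa_0(\mathbf x)\}=\bigcap_{i\ge0}\Phi(x_i)$ for $\mathbf x\in\mathcal R_v$. The induced bijection $\kappa:\partial X\to K$ is $\kappa(\xi):=\kappa_0(\mathbf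 x)$ for any ray $\mathbf x\in\mathcal R_v$ converging to $\xi$ (part of the assertion is that this is well defined and bijective). The $AI_\infty$-graph is $(X,E^{(\infty)})$ with $E^{(\infty)}=E_v\cup E_h^{(\infty)}$, $E_h^{(\infty)}=\bigcup_{n\ge1}\{(x,y)\in X_n\times X_n\setminus\Delta:\Phi(x)\cap\Phi(y)\ne\emptyset\}$. *)

(* Defs.v *)
From HB Require Import structures.
From mathcomp Require Import all_boot all_order all_algebra.
From mathcomp Require Import all_classical all_reals all_analysis.

Set Implicit Arguments.
Unset Strict Implicit.
Unset Printing Implicit Defensive.

Import Order.TTheory GRing.Theory Num.Theory.
Import numFieldNormedType.Exports.

Local Open Scope classical_set_scope.
Local Open Scope card_scope.
Local Open Scope ring_scope.

Record rooted_graph (X : countType) := RootedGraph {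
  edge : rel X;
  groot : X;
  edge_sym : symmetric edge;
  edge_irr : irreflexive edge;
  edge_locally_finite : forall x, finite_set [set y | edge x y];
  edge_connected : forall x y, exists2 p : seq X, path edge x p & last x p = y
}.

Section graph.
Context {X : countType}.
Implicit Types (G : rooted_graph X) (x y : X).

(* [p] lists the vertices of the walk after its origin [x] *)
Definition walk G x y (p : seq X) := path (edge G) x p /\ last x p = y.

Lemma walk_length_ex G x y :
  exists n, `[< exists2 p, walk G x y p & size p = n >].
Proof.
have [p xp py] := edge_connected G x y.
by exists (size p); apply/asboolP; exists p.
Qed.

Definition gdist G x y : nat := ex_minn (walk_length_ex G x y).

Definition geodesic G x y (p : seq X) := walk G x y p /\ size p = gdist G x y.

Definition height G x : nat := gdist G (groot G) x.

Definition level G (n : nat) : set X := [set x | height G x = n].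

(* J_m(x) *)
Definition descendants G (m : nat) x : set X :=
  [set y | height G y = (height G x + m)%N /\
           exists2 p, geodesic G (groot G) y p & x \in groot G :: p].

Definition vertical G := forall x y, edge G x y -> height G x <> height G y.

Definition is_ray G (r : nat -> X) :=
  r 0%N = groot G /\ forall i, descendants G 1 (r i) (r i.+1).

Lemma gdist_le G x y p : walk G x y p -> (gdist G x y <= size p)%N.
Proof.
move=> xyp; rewrite /gdist; case: ex_minnP => m _; apply.
by apply/asboolP; exists p.
Qed.

Lemma geodesic_ex G x y : exists p, geodesic G x y p.
Proof.
rewrite /geodesic /gdist; case: ex_minnP => m /asboolP[p xyp <-] _.
by exists p.
Qed.

Lemma level0 G : level G 0 `<=` [set groot G].
Proof.
move=> x; rewrite /level /height /= => x0.
have [p [[_ px]]] := geodesic_ex G (groot G) x; rewrite x0 => /size0nil p0.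
by rewrite -px p0.
Qed.

Lemma levelS G n :
  level G n.+1 `<=` \bigcup_(x in level G n) [set y | edge G x y].
Proof.
move=> y; rewrite /level /height /= => yn.
have [p [[rp py]]] := geodesic_ex G (groot G) y; rewrite yn.
case/lastP: p rp py => // p z; rewrite rcons_path last_rcons size_rcons.
move=> /andP[rp ez] zy [pn]; rewrite {z}zy in ez.
exists (last (groot G) p) => //=.
have le_n : (gdist G (groot G) (last (groot G) p) <= n)%N by rewrite -pn gdist_le.
apply/eqP; rewrite eqn_leq le_n /= -ltnS -yn.
have [q [[rq ql] <-]] := geodesic_ex G (groot G) (last (groot G) p).
rewrite -(size_rcons q y); apply: gdist_le; split; last by rewrite last_rcons.
by rewrite rcons_path rq ql.
Qed.

Lemma finite_level G n : finite_set (level G n).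
Proof.
elim: n => [|n IHn]; first exact: sub_finite_set (@level0 G) (finite_set1 _).
apply: sub_finite_set (@levelS G n) _.
by apply: bigcup_finite => // x _; exact: edge_locally_finite.
Qed.

End graph.

Section gromov.
Context {R : realType} {X : countType}.
Implicit Types (G : rooted_graph X) (x y z : X).

Definition gromov_product G x y : R :=
  ((height G x)%:R + (height G y)%:R - (gdist G x y)%:R) / 2.

Definition hyperbolic_with G (delta : R) := forall x y z,
  gromov_product G x y >=
  Num.min (gromov_product G x z) (gromov_product G z y) - delta.

(* theta_a *)
Definition gromov_metric G (a : R) x y : R :=
  if x == y then 0 else
  inf [set s | exists (n : nat) (z : nat -> X),
    [/\ (1 <= n)%N, z 0%N = x, z n = y &
        s = \sum_(0 <= i < n) expR (- (a * gromov_product G (z i) (z i.+1)))]].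

Lemma gromov_metricxx G a x : gromov_metric G a x x = 0.
Proof. by rewrite /gromov_metric eqxx. Qed.

End gromov.

Definition hyperbolic (R : realType) (X : countType) (G : rooted_graph X) :=
  exists2 delta : R, 0 <= delta & hyperbolic_with G delta.

(* Cantor's completion of a space [T] with distance [d]: classes of Cauchy
   sequences at mutual distance tending to 0. *)
Section completion.
Context {R : realType} {T : Type} (d : T -> T -> R).

Definition cauchy_sequence (u : nat -> T) := forall e : R, 0 < e ->
  exists N, forall m n, (N <= m)%N -> (N <= n)%N -> d (u m) (u n) < e.

Definition cauchy_class (u : nat -> T) : set (nat -> T) :=
  [set v | cauchy_sequence v /\ d (u n) (v n) @[n --> \oo] --> (0 : R)].

Definition completion :=
  {C : set (nat -> T) | exists2 u, cauchy_sequence u & C = cauchy_class u}.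

Definition representative (C : completion) : nat -> T :=
  s2val (cid2 (svalP C)).

Definition completion_dist (C D : completion) : R :=
  lim (d (representative C n) (representative D n) @[n --> \oo]).

Hypothesis dxx : forall x, d x x = 0.

Lemma cauchy_sequence_cst x : cauchy_sequence (fun=> x).
Proof. by move=> e e0; exists 0%N => m n _ _; rewrite dxx. Qed.

Definition completion_embed (x : T) : completion :=
  exist _ (cauchy_class (fun=> x)) (ex_intro2 _ _ _ (cauchy_sequence_cst x) erefl).

End completion.

Section boundary.
Context {R : realType} {X : countType} (G : rooted_graph X) (a : R).

Definition gromov_completion := completion (gromov_metric G a).

Definition gromov_embed : X -> gromov_completion :=
  completion_embed (gromov_metricxx G a).

Definition boundary :=
  {xi : gromov_completion | forall x, xi <> gromov_embed x}.

Definition boundary_dist (xi eta : boundary) : R :=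
  completion_dist (sval xi) (sval eta).

Definition converges_to_boundary (r : nat -> X) (xi : boundary) :=
  completion_dist (gromov_embed (r n)) (sval xi) @[n --> \oo] --> (0 : R).

End boundary.

(* The library's [completeType] is pointed; [M] need not be. *)
Definition complete_space (M : uniformType) :=
  forall F : set_system M, ProperFilter F -> cauchy F -> exists l : M, F --> l.

Definition diam (R : realType) (M : metricType R) (F : set M) : \bar R :=
  ereal_sup (0%E |` [set (mdist x y)%:E | x in F & y in F]).

Section index_map.
Context {R : realType} {M : metricType R} {X : countType}.
Variables (G : rooted_graph X) (Phi : X -> set M).

Definition is_index_map :=
  [/\ forall x, Phi x !=set0,
      forall x, compact (Phi x),
      forall x y, descendants G 1 x y -> Phi y `<=` Phi x &
      forall r, is_ray G r -> exists p, \bigcap_i Phi (r i) = [set p]].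

Definition attractor : set M :=
  \bigcap_n \bigcup_(x in level G n) Phi x.

Definition cell (x : X) : set M := Phi x `&` attractor.

Definition exponential_type (b : R) :=
  exists (C : R) (N : nat), forall x, (N <= height G x)%N ->
    (diam (Phi x) <= (C * expR (- (b * (height G x)%:R)))%:E)%E.

(* (S_b) *)
Definition separation_condition (b : R) :=
  forall c : R, 0 < c -> exists l : nat, forall (n : nat) (F : set M),
    (diam F < (c * expR (- (b * n%:R)))%:E)%E ->
    [set x | level G n x /\ cell x `&` F !=set0] #<= (`I_l : set nat).

Definition AI_horizontal (x y : X) := exists2 n, (1 <= n)%N &
  [/\ level G n x, level G n y, x <> y & Phi x `&` Phi y !=set0].

Definition AI_edge : rel X :=
  fun x y => edge G x y || `[< AI_horizontal x y >].

Lemma AI_edge_sym : symmetric AI_edge.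
Proof.
move=> x y; rewrite /AI_edge edge_sym; congr (_ || _); apply/asbool_equiv_eq.
by split=> -[n n1 [xn yn xy]]; rewrite setIC; exists n => //; split=> //;
  apply/nesym.
Qed.

Lemma AI_edge_irr : irreflexive AI_edge.
Proof.
by move=> x; rewrite /AI_edge edge_irr /=; apply/asboolP => -[n _ []].
Qed.

Lemma AI_edge_locally_finite x : finite_set [set y | AI_edge x y].
Proof.
apply: (@sub_finite_set _ _ ([set y | edge G x y] `|` level G (height G x))).
  move=> y /orP[xy|/asboolP[n _ [xn yn _ _]]]; [by left|right].
  by rewrite /level /= xn.
by rewrite finite_setU; split; [exact: edge_locally_finite|exact: finite_level].
Qed.

Lemma AI_edge_connected x y : exists2 p, path AI_edge x p & last x p = y.
Proof.
have [p xp py] := edge_connected G x y; exists p => //.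
by apply: sub_path xp => u v uv; rewrite /AI_edge uv.
Qed.

(* the AI_infinity-graph *)
Definition AI_graph : rooted_graph X :=
  RootedGraph (groot G) AI_edge_sym AI_edge_irr AI_edge_locally_finite
    AI_edge_connected.

(* kappa(xi) = kappa_0(r) for every ray r converging to xi; the first clause
   gives each xi such a ray, so that at most one [kappa] qualifies. *)
Definition induced_map (a : R) (kappa : boundary AI_graph a -> M) :=
  (forall xi : boundary AI_graph a,
     exists2 r, is_ray G r & converges_to_boundary r xi) /\
  (forall xi r, is_ray G r -> converges_to_boundary r xi ->
     \bigcap_i Phi (r i) = [set kappa xi]).

End index_map.

(* Main.v *)
(* Write |z| for levels and d for the distance of the AI_infinity-graph.  Along a
   geodesic z_0, ..., z_d from x to y one has |z_i| >= (x|y) + |i - i_0| for some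
   i_0, because consecutive levels differ by at most one.  Consecutive Phi(z_i)
   intersect and have diameter O(e^{-b|z_i|}), so their union has diameter
   O(e^{-b(x|y)}), a geometric series; this is the Hoelder estimate.  Project the
   geodesic to level n <= (x|y) by replacing each vertex by its ancestor: by (S_b)
   the projected walk visits boundedly many vertices, so the ancestors of x and y
   at level n are at bounded distance.  Applied to the pairs (x,z) and (z,y), this
   gives hyperbolicity.  The estimate passes to theta_a because
   e^{-a(x|y)} <= 2 theta_a(x,y) for x <> y (Frink's chain argument, which uses
   e^{2 delta a} <= 2).  Rays converging to given boundary points are produced by
   Koenig's lemma. *)

Require Import Defs.
From mathcomp Require Import all_boot all_order all_algebra.
From mathcomp Require Import all_classical all_reals all_analysis.
From mathcomp Require Import zify ring lra.

Set Implicit Arguments.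
Unset Strict Implicit.
Unset Printing Implicit Defensive.

Import Order.TTheory GRing.Theory Num.Theory.
Import numFieldNormedType.Exports.

Local Open Scope classical_set_scope.
Local Open Scope ring_scope.

(** * Graph distance, ancestors and rays *)

Section graph_distance.
Context {X : countType}.
Implicit Types (G : rooted_graph X) (x y z : X).

Lemma gdistxx G x : gdist G x x = 0%N.
Proof. by apply/eqP; rewrite -leqn0; apply: (@gdist_le _ _ _ _ [::]). Qed.

Lemma gdist_edge G x y : edge G x y -> (gdist G x y <= 1)%N.
Proof. by move=> xy; apply: (@gdist_le _ _ _ _ [:: y]); split => //=; rewrite xy. Qed.

Lemma gdist_triangle G y x z : (gdist G x z <= gdist G x y + gdist G y z)%N.
Proof.
have [p [[xp py] <-]] := geodesic_ex G x y.
have [q [[yq qz] <-]] := geodesic_ex G y z.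
rewrite -size_cat; apply: gdist_le; split.
  by rewrite cat_path xp py.
by rewrite last_cat py.
Qed.

Lemma gdist_sym G x y : gdist G x y = gdist G y x.
Proof.
wlog suff le : x y / (gdist G x y <= gdist G y x)%N.
  by apply/eqP; rewrite eqn_leq !le.
have [p [[yp px] <-]] := geodesic_ex G y x.
rewrite -(size_belast y p) -size_rev; apply: gdist_le; split.
  rewrite -px rev_path; apply: sub_path yp => u v.
  by rewrite edge_sym.
case: p px {yp} => [//|c p] /= _.
by rewrite rev_cons last_rcons.
Qed.

Lemma height_root G : height G (groot G) = 0%N.
Proof. exact: gdistxx. Qed.

Lemma height0 G x : height G x = 0%N -> x = groot G.
Proof. exact: level0. Qed.

Lemma height_gdist G x y : (height G x <= height G y + gdist G x y)%N.
Proof. by rewrite (gdist_sym G x y); exact: gdist_triangle. Qed.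

Lemma height_edge G x y : edge G x y -> (height G y <= (height G x).+1)%N.
Proof.
move=> /gdist_edge xy; apply: leq_trans (gdist_triangle _ x _ _) _.
by rewrite -addn1 leq_add2l.
Qed.

Lemma descendants1 G x y :
  edge G x y -> height G y = (height G x).+1 -> descendants G 1 x y.
Proof.
move=> xy hy; split; first by rewrite addn1.
have [p [[rp px] sp]] := geodesic_ex G (groot G) x.
exists (rcons p y); last first.
  by rewrite -px -rcons_cons mem_rcons inE mem_last orbT.
split; last by rewrite size_rcons sp -[RHS]/(height G y) hy.
by split; rewrite ?last_rcons// rcons_path rp px.
Qed.

(** A vertex may have several parents; fixing one of them makes [ancestor] a function. *)
Lemma parent_ex G : exists par : X -> X,
  forall x, x <> groot G ->
    edge G (par x) x /\ height G x = (height G (par x)).+1.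
Proof.
suff /choice[par parP] : forall x, exists y, x <> groot G ->
    edge G y x /\ height G x = (height G y).+1 by exists par.
move=> x; case hx: (height G x) => [|n].
  by exists x; rewrite (height0 hx).
have [y /= hy yx] := @levelS _ G n x hx.
by exists y => _; split => //; rewrite hy.
Qed.

End graph_distance.

Section ancestors.
Context {X : countType} (G : rooted_graph X) (par : X -> X).
Hypothesis parP : forall x, x <> groot G ->
  edge G (par x) x /\ height G x = (height G (par x)).+1.

Definition ancestor n x := iter (height G x - n) par x.

Lemma height_par x n : height G x = n.+1 -> height G (par x) = n.
Proof.
move=> hx; have [|_] := @parP x; last by rewrite hx => -[].
by move=> xr; rewrite xr height_root in hx.
Qed.

Lemma height_iter_par k x : (k <= height G x)%N ->
  height G (iter k par x) = (height G x - k)%N.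
Proof.
elim: k => [|k IH] hk; first by rewrite subn0.
by rewrite iterS (@height_par _ (height G x - k.+1)) // IH; lia.
Qed.

Lemma height_ancestor n x : (n <= height G x)%N -> height G (ancestor n x) = n.
Proof. by move=> nx; rewrite height_iter_par; lia. Qed.

Lemma gdist_iter_par k x : (k <= height G x)%N -> (gdist G (iter k par x) x <= k)%N.
Proof.
elim: k => [|k IH] hk; first by rewrite gdistxx.
apply: leq_trans (gdist_triangle _ (iter k par x) _ _) _.
apply: (@leq_add _ _ 1 k); last exact: IH (ltnW hk).
apply: gdist_edge.
have [|//] := @parP (iter k par x).
move=> /(congr1 (height G)); rewrite height_root height_iter_par; lia.
Qed.

Lemma gdist_ancestor n x : (n <= height G x)%N ->
  (gdist G (ancestor n x) x <= height G x - n)%N.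
Proof. by move=> nx; apply: gdist_iter_par; lia. Qed.

Lemma ancestor_id n x : height G x = n -> ancestor n x = x.
Proof. by rewrite /ancestor => ->; rewrite subnn. Qed.

Lemma par_ancestor n x : (n < height G x)%N ->
  par (ancestor n.+1 x) = ancestor n x.
Proof. by move=> nx; rewrite /ancestor -iterS -subSn // subSS. Qed.

Lemma descendants_ancestor n x : (n < height G x)%N ->
  descendants G 1 (ancestor n x) (ancestor n.+1 x).
Proof.
move=> nx; rewrite -par_ancestor //.
have hS := height_ancestor nx.
have [|e h] := @parP (ancestor n.+1 x).
  by move=> /(congr1 (height G)); rewrite hS height_root.
exact: descendants1.
Qed.

End ancestors.

(** * Koenig's lemma for chains of ancestors *)

Section koenig.

(** Induction on a list of [D]: either its head is taken at arbitrarily large indices satisfying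
    [P], or from some index on it never is and the tail suffices. The predicate [P] lets the
    argument be repeated on indices already selected. *)
Lemma infinite_pigeonhole (T : choiceType) (D : set T) (P : nat -> Prop)
    (f : nat -> T) : finite_set D ->
  (forall N, exists2 n, (N <= n)%N & P n /\ D (f n)) ->
  exists2 x, D x & forall N, exists2 n, (N <= n)%N & P n /\ f n = x.
Proof.
case/finite_seqP => s -> inf.
have : exists2 x, x \in s & forall N, exists2 n, (N <= n)%N & P n /\ f n = x.
  elim: s inf => [|c s IH] inf; first by have [? _ [_]] := inf 0%N.
  have [c_inf|] := pselect (forall N, exists2 n, (N <= n)%N & P n /\ f n = c).
    by exists c => //; rewrite mem_head.
  move=> /existsNP[N0 noc].
  have [N|x xs xinf] := IH; last by exists x => //; rewrite in_cons xs orbT.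
  have [n] := inf (maxn N N0); rewrite geq_max => /andP[Nn N0n] [Pn].
  rewrite /= in_cons => /orP[/eqP fn|fn]; last by exists n.
  by case: noc; exists n.
by [].
Qed.

Context {X : countType} (G : rooted_graph X) (par : X -> X).
Hypothesis parP : forall x, x <> groot G ->
  edge G (par x) x /\ height G x = (height G (par x)).+1.
Local Notation ancestor := (ancestor G par).

(** Levels are finite, so if a vertex is an ancestor of [u n] for arbitrarily large [n], then so is
    one of its children; following such children from the root gives the ray. *)
Lemma koenig (u : nat -> X) :
  (forall H, exists N, forall n, (N <= n)%N -> (H <= height G (u n))%N) ->
  exists2 r, is_ray G r & forall k N, exists2 n, (N <= n)%N &
    (k <= height G (u n))%N /\ ancestor k (u n) = r k.
Proof.
move=> uinf.
pose good k x := forall N, exists2 n, (N <= n)%N &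
  (k <= height G (u n))%N /\ ancestor k (u n) = x.
have good_height k x : good k x -> height G x = k.
  by move=> /(_ 0%N)[n _ [kn <-]]; exact: height_ancestor.
(* The goodness assumption sits inside the existential, so that [choice] yields a function defined
   on all pairs. *)
have step kx : exists y, good kx.1 kx.2 -> good kx.1.+1 y /\ par y = kx.2.
  case: kx => k x /=.
  have [gkx|ngkx] := pselect (good k x); last by exists x.
  have [|y _ yinf] := @infinite_pigeonhole _ (level G k.+1)
    (fun n => (k < height G (u n))%N /\ ancestor k (u n) = x)
    (fun n => ancestor k.+1 (u n)) (@finite_level _ _ _).
    move=> N; have [N1 HN1] := uinf k.+1.
    have [n] := gkx (maxn N N1); rewrite geq_max => /andP[Nn N1n] [kn ux].
    exists n => //; have {}kn := HN1 n N1n.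
    by split => //; exact: height_ancestor.
  exists y => _; split.
    by move=> N; have [n Nn [[kn _] uy]] := yinf N; exists n.
  by have [n _ [[kn <-] <-]] := yinf 0%N; exact: par_ancestor.
have [f fP] := choice step.
pose r := fix r k := if k is k'.+1 then f (k', r k') else groot G.
have rgood k : good k (r k).
  elim: k => [|k IH]; last by have [] := fP (k, r k) IH.
  move=> N; exists N => //; split => //.
  by apply: height0; exact: height_ancestor.
exists r => //; split => // i.
have <- : par (r i.+1) = r i by have [] := fP (i, r i) (rgood i).
have [n _ [hn <-]] := rgood i.+1 0%N.
by rewrite par_ancestor //; exact: descendants_ancestor.
Qed.

End koenig.

(** * Counting, diameters and a two-sided geometric series *)

Lemma uniq_size_card_le (T : choiceType) (s : seq T) (S : set T) (l : nat) :
  uniq s -> {subset s <= S} -> (S #<= (`I_l : set nat))%card -> (size s <= l)%N.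
Proof.
case: s => // x0 s us sS Sl; rewrite -card_le_II; apply: card_le_trans Sl.
pose f := nth x0 (x0 :: s).
have /card_eqPle[_ le] :
    (f @` `I_(size (x0 :: s)) #= (`I_(size (x0 :: s)) : set nat))%card.
  apply: inj_card_eq => i j; rewrite !inE /= => hi hj /eqP.
  by rewrite nth_uniq // => /eqP.
apply: card_le_trans le _.
by apply: subset_card_le => _ [i /= hi <-]; apply: set_mem; exact/sS/mem_nth.
Qed.

Lemma diam_ge (R : realType) (M : metricType R) (F : set M) x y :
  F x -> F y -> ((mdist x y)%:E <= diam F)%E.
Proof. by move=> Fx Fy; apply: ereal_sup_ubound; right; exists x => //; exists y. Qed.

Lemma diam_le (R : realType) (M : metricType R) (F : set M) (c : R) : 0 <= c ->
  (forall x y, F x -> F y -> mdist x y <= c) -> (diam F <= c%:E)%E.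
Proof.
move=> c0 Fc; apply: ge_ereal_sup => _ [->|[x Fx [y Fy <-]]]; rewrite lee_fin //.
exact: Fc.
Qed.

(** Every point of [F] has a unit ball on which the distance to [p0] is below all large integers;
    compactness makes one integer work on all of [F]. *)
Lemma compact_mdist_bounded (R : realType) (M : metricType R) (F : set M) :
  compact F -> exists2 D : R, 0 <= D & forall p q, F p -> F q -> mdist p q <= D.
Proof.
have [[p0 Fp0]|F0] := pselect (F !=set0); last first.
  by move=> _; exists 0 => // p q Fp; case: F0; exists p.
move=> /compact_near_coveringP cF.
have [x Fx|n _ /= nF] := cF nat \oo (fun n x => mdist p0 x < n%:R).
  near=> x' n => /=; apply: le_lt_trans (metric_triangle _ x _) _.
  have xx' : mdist x x' < 1.
    near: x'; move: (nbhsx_ballx x 1 ltr01).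
    by rewrite ballEmdist.
  have hn : mdist p0 x + 1 < n%:R by near: n; exact: nbhs_infty_gtr.
  by apply: lt_trans hn; rewrite ltrD2l.
exists (n%:R + n%:R); first by rewrite addr_ge0.
move=> p q Fp Fq; apply: le_trans (metric_triangle _ p0 _) _.
have nn : (n <= n)%N by [].
by rewrite lerD // ?(metric_sym p p0) ltW //; exact: (nF _ nn).
Unshelve. all: by end_near.
Qed.

Lemma sum_expr_dist_le (R : realType) (r : R) (m N : nat) : 0 <= r -> r < 1 ->
  \sum_(0 <= i < N) r ^+ ((m - i) + (i - m)) <= 2 / (1 - r).
Proof.
move=> r0 r1; have r1' : 0 < 1 - r by rewrite subr_gt0.
(* This numerator makes the induction on [m'] exact: passing to [m'.+1] shifts the series and adds a
   first term [r ^+ m'.+1], which is precisely the change of the bound. *)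
suff le m' N' : \sum_(0 <= i < N') r ^+ ((m' - i) + (i - m')) <=
    (2 - r ^+ m'.+1) / (1 - r).
  by apply: le_trans (le _ _) _; rewrite ler_pM2r ?invr_gt0// gerBl exprn_ge0.
elim: m' N' => [|{}m' IH] [|{}N'].
- by rewrite big_geq// divr_ge0 ?ltW // expr1; lra.
- rewrite ler_pdivlMr// mulrC.
  under eq_bigr do rewrite sub0n subn0 add0n.
  have := subrX1 r N'.+1; have := exprn_ge0 N'.+1 r0.
  rewrite big_mkord expr1; move: (\sum_(i < _) _) (r ^+ _) => S rN.
  move=> rN0 rNE; have : (1 - r) * S = 1 - rN by lra.
  lra.
- rewrite big_geq// divr_ge0 ?(ltW r1') // subr_ge0.
  by rewrite (le_trans (exprn_ile1 _ _ _)) ?(ltW r1) //; lra.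
- rewrite big_nat_recl // subn0 sub0n addn0 (eq_bigr _ (fun i _ => erefl)).
  apply: le_trans (lerD (lexx _) (IH N')) _.
  rewrite le_eqVlt; apply/orP; left; apply/eqP.
  rewrite !exprS; field; lra.
Qed.

(** * Geometry of the AI_infinity-graph *)

Section geodesic_profile.
Context {X : countType}.
Implicit Types (G : rooted_graph X) (x y : X).

(* With d = size s, the hypothesis says that n is at most the Gromov product of
   x and y: a geodesic stays above level n and leaves it at unit speed on both
   sides of the position |x| - n. *)
Lemma geodesic_height G x y s n i : geodesic G x y s ->
  (n.*2 + size s <= height G x + height G y)%N -> (i <= size s)%N ->
  (n + (height G x - n - i + (i - (height G x - n))) <=
   height G (nth x (x :: s) i))%N.
Proof.
move=> [[xs sy] ss] hn hi; set z := nth _ _ _.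
have zE : z = last x (take i s).
  by rewrite (last_nth x) size_take_min (minn_idPl hi) /z; case: (i) => //= j; rewrite nth_take.
have xz : (gdist G x z <= i)%N.
  rewrite -[leqRHS](minn_idPl hi) -size_take_min; apply: gdist_le; split => //.
  by move: xs; rewrite -{1}(cat_take_drop i s) cat_path => /andP[].
have zy : (gdist G z y <= size s - i)%N.
  rewrite -size_drop; apply: gdist_le; split.
    by move: xs; rewrite -{1}(cat_take_drop i s) cat_path zE => /andP[].
  by rewrite zE -last_cat cat_take_drop.
have := height_gdist G x z; have := height_gdist G y z.
have := height_gdist G y x; rewrite (gdist_sym G y z) (gdist_sym G y x) -ss.
lia.
Qed.

Lemma geodesic_height_ge G x y s n z : geodesic G x y s ->
  (n.*2 + size s <= height G x + height G y)%N -> z \in x :: s ->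
  (n <= height G z)%N.
Proof.
move=> xys hn /(nthP x)[i hi <-].
by apply: leq_trans (geodesic_height xys hn hi); exact: leq_addr.
Qed.

Lemma gdist_le_path G (e : rel X) x s :
  (forall u v, e u v -> (gdist G u v <= 1)%N) -> path e x s ->
  (gdist G x (last x s) <= size s)%N.
Proof.
move=> e1; elim: s x => [|y s IH] x /=; first by rewrite gdistxx.
move=> /andP[/e1 xy ys]; apply: leq_trans (gdist_triangle _ y _ _) _.
exact: (leq_add xy (IH _ ys)).
Qed.

End geodesic_profile.

Section AI_graph_geometry.
Context {R : realType} {M : metricType R} {X : countType}.
Variables (G : rooted_graph X) (Phi : X -> set M) (par : X -> X).
Hypothesis parP : forall x, x <> groot G ->
  edge G (par x) x /\ height G x = (height G (par x)).+1.
Hypothesis G_vertical : vertical G.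
Hypothesis G_children : forall x, descendants G 1 x !=set0.
Hypothesis Phi_index : is_index_map G Phi.

Local Notation A := (AI_graph G Phi).
Local Notation ancestor := (ancestor G par).

(** Horizontal edges stay in one level, so a walk using them still climbs at most one level per step
    and reaches no vertex sooner. *)
Lemma AI_height x : height A x = height G x.
Proof.
apply/eqP; rewrite eqn_leq; apply/andP; split.
  have [p [[xp px] sp]] := geodesic_ex G (groot G) x; rewrite -[leqRHS]sp.
  apply: gdist_le; split => //=; apply: sub_path xp => u v uv.
  by rewrite /AI_edge uv.
have [p [[xp <-] sp]] := geodesic_ex A (groot G) x; rewrite -[leqRHS]sp.
suff H u s : path (AI_edge G Phi) u s ->
    (height G (last u s) <= height G u + size s)%N.
  by apply: leq_trans (H _ _ xp) _; rewrite height_root.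
elim: s u => [|v s IH] u /=; first by rewrite addn0.
move=> /andP[uv vs]; apply: leq_trans (IH _ vs) _.
rewrite addnS -addSn leq_add2r.
by case/orP: uv => [/height_edge//|/asboolP[n _ [-> ->]]].
Qed.

Lemma Phi_ancestor n x : (n <= height G x)%N -> Phi x `<=` Phi (ancestor n x).
Proof.
have [_ _ Phi_desc _] := Phi_index.
move=> nx; rewrite -{1}(@ancestor_id _ G par _ x erefl).
elim: (height G x - n)%N {-2}n (erefl (height G x - n)%N) nx => [|k IH] m km mx.
  by have -> : m = height G x by lia.
apply: subset_trans (IH m.+1 _ _) _; [lia..|].
by apply: Phi_desc; apply: descendants_ancestor => //; lia.
Qed.

(** Verticality makes an edge of [G] join different levels, so one of the two sets contains the
    other; horizontal edges meet by definition. *)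
Lemma AI_edge_meet x y : AI_edge G Phi x y -> Phi x `&` Phi y !=set0.
Proof.
have [Phi0 _ Phi_desc _] := Phi_index.
have edge_meet u v : edge G u v -> (height G u < height G v)%N ->
    Phi u `&` Phi v !=set0.
  move=> uv huv; have [p vp] := Phi0 v; exists p; split => //.
  apply: Phi_desc p vp; apply: descendants1 => //.
  by have := height_edge uv; lia.
case/orP => [xy|/asboolP[n _ []//]].
have := G_vertical xy; move/eqP; rewrite neq_ltn => /orP[|yx]; first exact: edge_meet.
by rewrite setIC; apply: edge_meet => //; rewrite edge_sym.
Qed.

Lemma meet_gdist x y : height G x = height G y -> Phi x `&` Phi y !=set0 ->
  (gdist A x y <= 1)%N.
Proof.
move=> hxy xy; have [->|/eqP nxy] := eqVneq x y; first by rewrite gdistxx.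
(* [AI_horizontal] starts at level 1; level 0 consists of the root alone. *)
case hx : (height G x) => [|n].
  by case: nxy; rewrite (height0 hx) (@height0 _ G y) // -hxy.
apply: gdist_edge; apply/orP; right; apply/asboolP; exists n.+1 => //.
by split => //; rewrite /level /= -hxy.
Qed.

Lemma gdist_AI_ancestor n x : (n <= height G x)%N ->
  (gdist A (ancestor n x) x <= height G x - n)%N.
Proof.
move=> nx; apply: leq_trans (gdist_ancestor parP nx).
have [p [[xp px] <-]] := geodesic_ex G (ancestor n x) x.
apply: gdist_le; split => //=; apply: sub_path xp => u v uv.
by rewrite /AI_edge uv.
Qed.

(** The deeper vertex is replaced by its ancestor at the level of the other; the enlarged set still
    meets the other one, so one horizontal step closes the walk. *)
Lemma meet_gdist_le x y : Phi x `&` Phi y !=set0 ->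
  (gdist A x y <=
   (maxn (height G x) (height G y) - minn (height G x) (height G y)).+1)%N.
Proof.
wlog xy : x y / (height G x <= height G y)%N.
  move=> H; case/orP: (leq_total (height G x) (height G y)) => hxy; first exact: H.
  by rewrite setIC => /(H _ _ hxy); rewrite gdist_sym maxnC minnC.
move=> [p [px py]]; rewrite (maxn_idPr xy) (minn_idPl xy) -add1n.
apply: leq_trans (gdist_triangle _ (ancestor (height G x) y) _ _) _.
apply: leq_add; last exact: gdist_AI_ancestor.
apply: meet_gdist; first by rewrite height_ancestor.
by exists p; split => //; exact: Phi_ancestor.
Qed.

Lemma meet_gromov x y k : Phi x `&` Phi y !=set0 ->
  (k <= height G x)%N -> (k <= height G y)%N ->
  k%:R - 1 / 2 <= gromov_product A x y :> R.
Proof.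
move=> /meet_gdist_le d hx hy.
have : (k.*2 + gdist A x y <= height G x + height G y + 1)%N by lia.
rewrite -(ler_nat R) -addnn !natrD /gromov_product !AI_height; lra.
Qed.

(** Condition (S_b) counts vertices by [cell] and not by [Phi]. A ray through [x], made of its
    ancestors and then of iterated children, has its limit point in [Phi x] and in the attractor. *)
Lemma cell_nonempty x : cell G Phi x !=set0.
Proof.
have [child childP] := choice G_children.
pose r i := if (i <= height G x)%N then ancestor i x
  else iter (i - height G x) child x.
have hr k : height G (iter k child x) = (height G x + k)%N.
  elim: k => [|k IH]; first by rewrite addn0.
  by have [-> _] := childP (iter k child x); rewrite IH addn1 addnS.
have ray_r : is_ray G r.
  split; first by apply: height0; rewrite /r leq0n height_ancestor.
  move=> i; rewrite /r; case: (ltngtP i (height G x)) => hi.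
  - exact: descendants_ancestor.
  - by rewrite subSn ?iterS //; exact: ltnW.
  - by rewrite hi ancestor_id // subSnn.
have [_ _ _ /(_ r ray_r)[p pE]] := Phi_index.
have pr i : Phi (r i) p.
  have : (\bigcap_i Phi (r i)) p by rewrite pE.
  exact.
exists p; split.
  by have := pr (height G x); rewrite /r leqnn ancestor_id.
move=> n _; exists (r n) => //; rewrite /level /= /r; case: leqP => hn.
  by rewrite height_ancestor.
by rewrite hr; lia.
Qed.

Section diameters.
Variables (r C : R).
Hypotheses (r0 : 0 < r) (r1 : r < 1) (C0 : 0 < C).
Hypothesis Phi_dist : forall x p q, Phi x p -> Phi x q ->
  mdist p q <= C * r ^+ height G x.

(** Consecutive sets share a point, so the triangle inequality adds up the diameter bounds along the
    walk. *)
Lemma path_dist x s p z q : path (AI_edge G Phi) x s ->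
  Phi x p -> z \in x :: s -> Phi z q ->
  mdist p q <= C * \sum_(y <- x :: s) r ^+ height G y.
Proof.
elim: s x p => [|y s IH] x p.
  by move=> _ xp; rewrite mem_seq1 => /eqP -> xq; rewrite big_seq1; exact: Phi_dist.
move=> /= /andP[xy ys] xp; rewrite in_cons big_cons mulrDr => /orP[/eqP->|zs] zq.
  apply: le_trans (Phi_dist xp zq) _; rewrite lerDl mulr_ge0 ?(ltW C0) //.
  by apply: sumr_ge0 => i _; rewrite exprn_ge0 // ltW.
have [c [xc yc]] := AI_edge_meet xy.
apply: le_trans (metric_triangle _ c _) _.
by rewrite lerD ?Phi_dist // IH.
Qed.

(** By [geodesic_height] the heights exceed [n] by at least the distance to a fixed position, so the
    sum in [path_dist] is dominated by a two-sided geometric series. *)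
Lemma geodesic_dist x y s n p z q : geodesic A x y s ->
  (n.*2 + size s <= height G x + height G y)%N ->
  Phi x p -> z \in x :: s -> Phi z q ->
  mdist p q <= C * (2 / (1 - r)) * r ^+ n.
Proof.
move=> xys hn xp zs zq; have [[xs _] _] := xys.
apply: le_trans (path_dist xs xp zs zq) _.
rewrite -mulrA ler_wpM2l ?(ltW C0) // (big_nth x) [leRHS]mulrC.
have := sum_expr_dist_le (height G x - n) (size (x :: s)) (ltW r0) r1.
move=> /(ler_wpM2l (exprn_ge0 n (ltW r0))); apply: le_trans.
rewrite mulr_sumr !big_mkord; apply: ler_sum => -[i hi] _ /=.
rewrite -exprD -!AI_height; apply: ler_wiXn2l; rewrite ?ltW //.
by apply: geodesic_height xys _ hi; rewrite !AI_height.
Qed.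

Lemma ancestor_gdist_bounded (b : R) : r = expR (- b) -> separation_condition G Phi b ->
  exists l, forall n x y, (n.*2 + gdist A x y <= height G x + height G y)%N ->
    (gdist A (ancestor n x) (ancestor n y) <= l)%N.
Proof.
move=> rE sep; pose B := C * (2 / (1 - r)).
have B0 : 0 < B by rewrite !mulr_gt0 ?invr_gt0 ?subr_gt0.
(* Every point of the set [F] below lies within [B * r ^+ n] of one point of [Phi x], so [diam F] is
   at most twice that; the added 1 makes the inequality of (S_b) strict. *)
have [|l lP] := sep (B + B + 1); first by rewrite !addr_gt0.
exists l => n x y; have [s xys] := geodesic_ex A x y.
have [[xs sy] <-] := xys => hn.
pose F := \bigcup_(z in [set` x :: s]) Phi z.
have Fdiam : (diam F < ((B + B + 1) * expR (- (b * n%:R)))%:E)%E.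
  have -> : expR (- (b * n%:R)) = r ^+ n by rewrite rE -expRM_natl mulrN mulrC.
  apply: (@le_lt_trans _ _ ((B + B) * r ^+ n)%:E); last first.
    by rewrite lte_fin ltr_pM2r ?exprn_gt0 // ltrDl.
  have [p xp] : Phi x !=set0 by have [] := Phi_index.
  apply: diam_le => [|q q' [z /= zs zq] [z' /= zs' zq']].
    by rewrite mulr_ge0 ?exprn_ge0 ?addr_ge0 ?ltW.
  rewrite mulrDl (le_trans (metric_triangle _ p _)) // lerD // ?(metric_sym q).
    exact: geodesic_dist xys hn xp zs zq.
  exact: geodesic_dist xys hn xp zs' zq'.
have hs z : z \in x :: s -> (n <= height G z)%N.
  by rewrite -AI_height; apply: geodesic_height_ge xys _; rewrite !AI_height.
(* Unlike [AI_edge], this relation allows a vertex to be repeated, as happens when neighbours on the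
   geodesic have the same ancestor; [shortenP] then cuts out all repetitions. *)
pose e u v := (height G u == height G v) && `[< Phi u `&` Phi v !=set0 >].
have : path e (ancestor n x) (map (ancestor n) s).
  rewrite path_map.
  apply: (@sub_in_path _ [pred z | n <= height G z]%N (AI_edge G Phi)) => //.
    move=> u v; rewrite !inE => hu hv /AI_edge_meet[c [uc vc]].
    rewrite /= /e !height_ancestor // eqxx /=; apply/asboolP; exists c.
    by split; exact: Phi_ancestor.
  by apply/allP => z; exact: hs.
rewrite -sy -(last_map (ancestor n)) => /shortenP[s' xs' us' ss'].
apply: (@leq_trans (size s')).
  by apply: gdist_le_path xs' => u v /andP[/eqP huv /asboolP]; exact: meet_gdist.
apply: ltnW; apply: uniq_size_card_le us' _ (lP n F Fdiam) => u us.
have : u \in map (ancestor n) (x :: s).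
  by move: us; rewrite map_cons !in_cons => /orP[->//|/ss' ->]; rewrite orbT.
case/mapP => z zs ->; apply/mem_set; split.
  by rewrite /level /= height_ancestor // hs.
(* A point of [cell z] lies in [F], in the attractor and in [Phi] of the ancestor of [z], so that
   ancestor is among the vertices counted by (S_b). *)
have [c [zc Kc]] := cell_nonempty z.
by exists c; split; [split => //; exact: Phi_ancestor (hs _ zs) c zc|exists z].
Qed.

End diameters.
End AI_graph_geometry.

(** * Hyperbolicity, and the Hoelder estimate for vertices *)

Section AI_graph_gromov.
Context {R : realType} {M : metricType R} {X : countType}.
Variables (G : rooted_graph X) (Phi : X -> set M) (b : R).
Hypothesis G_vertical : vertical G.
Hypothesis G_children : forall x, descendants G 1 x !=set0.
Hypothesis Phi_index : is_index_map G Phi.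
Hypothesis b0 : 0 < b.
Hypothesis Phi_exp : exponential_type G Phi b.

Local Notation A := (AI_graph G Phi).
Local Notation gp := (gromov_product A : X -> X -> R).

(** The exponential bound is given only from level [N] on. At lower levels every [Phi x] lies in the
    compact set [Phi (groot G)], where distances are at most [D], and the factor [expR (b * N%:R)]
    absorbs the decay. *)
Lemma exponential_mdist : exists2 C : R, 0 < C &
  forall x p q, Phi x p -> Phi x q -> mdist p q <= C * expR (- b) ^+ height G x.
Proof.
have [_ Phi_cpt _ _] := Phi_index.
have [par parP] := parent_ex G.
have [C [N CN]] := Phi_exp.
have [D D0 DP] := compact_mdist_bounded (Phi_cpt (groot G)).
have er n : expR (- (b * n%:R)) = expR (- b) ^+ n :> R by rewrite -expRM_natl mulrN mulrC.
have DN : 0 <= D * expR (b * N%:R) by rewrite mulr_ge0 ?expR_ge0.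
exists (`|C| + D * expR (b * N%:R) + 1); first by rewrite ltr_wpDl ?addr_ge0.
move=> x p q xp xq; rewrite -er; case: (leqP N (height G x)) => hx.
  have := le_trans (diam_ge xp xq) (CN x hx); rewrite lee_fin => /le_trans; apply.
  rewrite ler_pM2r ?expR_gt0 //; have := ler_norm C; lra.
have root_sub : Phi x `<=` Phi (groot G).
  have := Phi_ancestor parP Phi_index (leq0n (height G x)).
  by rewrite (@height0 _ G (ancestor G par 0 x)) // height_ancestor.
apply: le_trans (DP _ _ (root_sub _ xp) (root_sub _ xq)) _.
apply: (@le_trans _ _ (D * expR (b * N%:R) * expR (- (b * (height G x)%:R)))).
  rewrite -mulrA -expRD; apply: ler_peMr => //.
  by rewrite -[leLHS]expR0 ler_expR subr_ge0 ler_pM2l // ler_nat ltnW.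
by rewrite ler_pM2r ?expR_gt0 // addrAC lerDr addr_ge0.
Qed.

Lemma expRNb_lt1 : expR (- b) < 1.
Proof. by rewrite -expR0 ltr_expR oppr_lt0. Qed.

Lemma AI_hyperbolic : separation_condition G Phi b -> hyperbolic R A.
Proof.
move=> sep; have [par parP] := parent_ex G.
have [C C0 Phi_dist] := exponential_mdist.
have [l lP] := ancestor_gdist_bounded parP G_vertical G_children Phi_index
  (expR_gt0 _) expRNb_lt1 C0 Phi_dist erefl sep.
(* With [n] the integer part of the smaller product, the walk through the ancestors at level [n]
   gives (x|y) >= n - l, and rounding costs at most 1/2. *)
exists l.+1%:R => // x y z; rewrite /gromov_product !AI_height.
set hx := height G x; set hy := height G y; set hz := height G z.
set dxy := gdist A x y; set dxz := gdist A x z; set dzy := gdist A z y.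
suff [H|H] : (hx + hz + dxy <= hx + hy + dxz + l.+1.*2)%N \/
             (hz + hy + dxy <= hx + hy + dzy + l.+1.*2)%N.
  - move: H; rewrite -(ler_nat R) -addnn !natrD => H.
    by rewrite lerBlDr ge_min; apply/orP; left; lra.
  - move: H; rewrite -(ler_nat R) -addnn !natrD => H.
    by rewrite lerBlDr ge_min; apply/orP; right; lra.
pose n := (minn (hx + hz - dxz) (hz + hy - dzy))./2.
(* These inequalities make the truncated subtractions in [n] exact and keep [n] below all heights
   involved. *)
have := height_gdist A x z; have := height_gdist A z x; rewrite (gdist_sym A z x).
have := height_gdist A y z; have := height_gdist A z y; rewrite (gdist_sym A y z).
have := gdist_triangle A (groot A) x z; rewrite (gdist_sym A x (groot A)) -!/(height A _).
have := gdist_triangle A (groot A) z y; rewrite (gdist_sym A z (groot A)) -!/(height A _).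
rewrite !AI_height -/hx -/hy -/hz -/dxz -/dzy => zy0 xz0 h1 h2 h3 h4.
have [nxz nzy] : (n.*2 <= hx + hz - dxz)%N /\ (n.*2 <= hz + hy - dzy)%N.
  by rewrite /n; lia.
have nge : (hx + hz - dxz <= n.*2.+1)%N \/ (hz + hy - dzy <= n.*2.+1)%N.
  by rewrite /n; lia.
clearbody n; have [nx ny] : (n <= hx)%N /\ (n <= hy)%N by lia.
have := lP n x z; rewrite -/hx -/hz -/dxz => /(_ ltac:(lia)) lxz.
have := lP n z y; rewrite -/hy -/hz -/dzy => /(_ ltac:(lia)) lzy.
have := gdist_triangle A (ancestor G par n z) (ancestor G par n x) (ancestor G par n y).
have := gdist_triangle A (ancestor G par n y) (ancestor G par n x) y.
have := gdist_triangle A (ancestor G par n x) x y; rewrite (gdist_sym A x (ancestor _ _ _ _)).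
have := gdist_AI_ancestor Phi parP nx; have := gdist_AI_ancestor Phi parP ny.
rewrite -/hx -/hy -/dxy; lia.
Qed.

Lemma mdist_gromov : exists2 B : R, 0 < B & forall x y p q, Phi x p -> Phi y q ->
  mdist p q <= B * expR (- (b * gp x y)).
Proof.
have [C C0 Phi_dist] := exponential_mdist.
(* The factor [expR (b / 2)] pays for rounding the Gromov product down to the integer [n]. *)
exists (C * (2 / (1 - expR (- b))) * expR (b / 2)).
  by rewrite !mulr_gt0 ?expR_gt0 // invr_gt0 subr_gt0 expRNb_lt1.
move=> x y p q xp yq; have [s xys] := geodesic_ex A x y; have [[_ sy] ss] := xys.
have := gdist_triangle A (groot A) x y; rewrite (gdist_sym A x (groot A)) -!/(height A _).
rewrite !AI_height => h.
pose n := (height G x + height G y - gdist A x y)./2.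
have ys : y \in x :: s by rewrite -sy mem_last.
have hn : (n.*2 + size s <= height G x + height G y)%N by rewrite ss /n; lia.
apply: le_trans (geodesic_dist G_vertical Phi_index (expR_gt0 _) expRNb_lt1 C0
  Phi_dist xys hn xp ys yq) _.
rewrite -[leRHS]mulrA ler_wpM2l //.
  by rewrite mulr_ge0 ?(ltW C0) // divr_ge0 // subr_ge0 ltW // expRNb_lt1.
rewrite -expRM_natl -expRD ler_expR /gromov_product !AI_height.
have : (height G x + height G y <= n.*2 + 1 + gdist A x y)%N by rewrite /n; lia.
rewrite -(ler_nat R) -addnn !natrD => {}hn.
have := ler_wpM2l (ltW b0) hn; rewrite !mulrDr; lra.
Qed.

End AI_graph_gromov.

(** * The Gromov metric *)

Section chain_inequality.
Context {R : realFieldType} {T : Type} (q : T -> T -> R) (K : R).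
Hypotheses (q0 : forall x y, 0 <= q x y) (K1 : 1 <= K) (K2 : K ^+ 2 <= 2).
Hypothesis qK : forall x y z, q x y <= K * Num.max (q x z) (q z y).

(* Cut the chain at its first step i such that the sum up to and including that
   step reaches half of the total: both remaining pieces have sum at most half
   of the total, so the constant 2 is reproduced because K^2 <= 2. *)
Lemma chain_le (z : nat -> T) m n : (m < n)%N ->
  q (z m) (z n) <= 2 * \sum_(m <= i < n) q (z i) (z i.+1).
Proof.
have K0 : 0 <= K := le_trans ler01 K1.
have qKle x y w t : q x w <= t -> q w y <= t -> q x y <= K * t.
  move=> xw wy; apply: le_trans (qK x y w) _.
  by rewrite ler_wpM2l // ge_max xw.
have [k] := ubnP (n - m); elim: k m n => // k IH m n nm mn; set S := \sum_(_ <= i < _) _.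
have sum0 i j : 0 <= \sum_(i <= l < j) q (z l) (z l.+1).
  by apply: sumr_ge0.
have [i [mi ni hi1 hi2]] : exists i, [/\ (m <= i)%N, (i < n)%N,
    \sum_(m <= l < i) q (z l) (z l.+1) <= S / 2 &
    \sum_(i.+1 <= l < n) q (z l) (z l.+1) <= S / 2].
  pose P j := (m < j)%N && (S / 2 <= \sum_(m <= l < j) q (z l) (z l.+1)).
  have exP : exists j, P j.
    by exists n; rewrite /P mn /= -/S; have := sum0 m n; rewrite -/S; lra.
  case: (ex_minnP exP) => -[|i] // /andP[mi Pi] minP.
  have lein : (i.+1 <= n)%N.
    by apply: minP; rewrite /P mn /= -/S; have := sum0 m n; rewrite -/S; lra.
  exists i; split => //.
    have := minP i; rewrite /P; move: mi; rewrite ltnS leq_eqVlt => /orP[/eqP <- _|mi].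
      by rewrite big_geq //; have := sum0 m n; rewrite -/S; lra.
    rewrite mi /= ltnn; case: leP => // [_ /(_ isT)//|/ltW]; exact.
  have : S = \sum_(m <= l < i.+1) q (z l) (z l.+1) +
             \sum_(i.+1 <= l < n) q (z l) (z l.+1).
    by rewrite -big_cat_nat // ltnW.
  by lra.
have S_ge : q (z i) (z i.+1) <= S.
  rewrite /S (@big_cat_nat _ _ _ i) //= ?(ltnW ni) // (@big_ltn _ _ _ i) //.
  by have := sum0 m i; have := sum0 i.+1 n; lra.
have S0 : 0 <= S by exact: sum0.
have left_le : (m < i)%N -> q (z m) (z i) <= S.
  by move=> ltmi; apply: le_trans (IH _ _ _ ltmi) _; [lia|lra].
have right_le : (i.+1 < n)%N -> q (z i.+1) (z n) <= S.
  by move=> ltin; apply: le_trans (IH _ _ _ ltin) _; [lia|lra].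
have KS t : t <= K * S -> t <= 2 * S by move=> /le_trans; apply; have := K2; nra.
have [lin|] := ltnP i.+1 n; last first.
  move=> le_n; have -> : n = i.+1 by lia.
  have [lmi|] := ltnP m i; last by move=> le_m; rewrite (_ : m = i); [lra|lia].
  by apply/KS/(qKle _ _ (z i)) => //; exact: left_le.
have [lmi|] := ltnP m i; last first.
  move=> le_m; have -> : m = i by lia.
  by apply/KS/(qKle _ _ (z i.+1)) => //; exact: right_le.
have S_le : S <= K * S by exact: ler_peMl.
have := qKle _ _ (z i.+1) (K * S).
move=> /(_ _ _ (qKle _ _ (z i) _ (left_le lmi) S_ge) (le_trans (right_le lin) S_le)).
by move/le_trans; apply; rewrite mulrA -expr2 ler_wpM2r.
Qed.

End chain_inequality.

Section gromov_metric_theory.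
Context {R : realType} {X : countType} (G : rooted_graph X) (a : R).
Hypothesis a0 : 0 < a.
Implicit Types x y z : X.

Local Notation gp := (gromov_product G : X -> X -> R).
Local Notation theta := (gromov_metric G a).
Local Notation q := (fun x y => expR (- (a * gp x y))).

Let chains x y : set R := [set s | exists (n : nat) (z : nat -> X),
  [/\ (1 <= n)%N, z 0%N = x, z n = y &
      s = \sum_(0 <= i < n) q (z i) (z i.+1)]].

Let chains_lb x y : has_lbound (chains x y).
Proof.
by exists 0 => _ [n [z [_ _ _ ->]]]; apply: sumr_ge0 => i _; exact: expR_ge0.
Qed.

Let chains_step x y : chains x y (q x y).
Proof.
exists 1%N, (fun i => if i is 0%N then x else y); split => //.
by rewrite big_nat1.
Qed.

Let thetaE x y : x <> y -> theta x y = inf (chains x y).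
Proof. by rewrite /gromov_metric => /eqP/negPf->. Qed.

Lemma gromov_product_sym x y : gp x y = gp y x.
Proof. by rewrite /gromov_product gdist_sym (addrC (height G x)%:R). Qed.

Lemma gromov_product_le_height x y : gp x y <= (height G x)%:R.
Proof.
have := height_gdist G y x; rewrite gdist_sym -(ler_nat R) natrD /gromov_product; lra.
Qed.

Lemma gromov_metric_ge0 x y : 0 <= theta x y.
Proof.
have [->|/eqP xy] := eqVneq x y; first by rewrite gromov_metricxx.
rewrite thetaE //; apply: lb_le_inf; first by exists (q x y).
by move=> _ [n [z [_ _ _ ->]]]; apply: sumr_ge0 => i _; exact: expR_ge0.
Qed.

Lemma gromov_metric_le x y : theta x y <= q x y.
Proof.
have [->|/eqP xy] := eqVneq x y; first by rewrite gromov_metricxx expR_ge0.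
by rewrite thetaE //; apply: ge_inf.
Qed.

Lemma gromov_metric_sym x y : theta x y = theta y x.
Proof.
wlog suff le : x y / theta x y <= theta y x.
  by apply/eqP; rewrite eq_le !le.
have [->|/eqP xy] := eqVneq x y; first exact: lexx.
rewrite !thetaE //; last exact: nesym.
apply: lb_le_inf; first by exists (q y x).
move=> _ [n [z [n1 z0 zn ->]]]; apply: ge_inf => //.
exists n, (fun i => z (n - i)%N); split; rewrite ?subn0 ?subnn //.
rewrite big_nat_rev /=; apply: eq_big_nat => i /andP[_ ni].
by rewrite add0n gromov_product_sym -subSn // subSS.
Qed.

(** Chains from [x] to [z] and from [z] to [y] concatenate. Coinciding points are set apart, because
    [theta] vanishes there by convention and not as an infimum. *)
Lemma gromov_metric_triangle z x y : theta x y <= theta x z + theta z y.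
Proof.
have [->|/eqP xz] := eqVneq x z; first by rewrite gromov_metricxx add0r.
have [<-|/eqP zy] := eqVneq z y; first by rewrite gromov_metricxx addr0.
have [->|/eqP xy] := eqVneq x y.
  by rewrite gromov_metricxx addr_ge0 // gromov_metric_ge0.
rewrite !thetaE // -lerBlDr; apply: lb_le_inf; first by exists (q x z).
move=> _ [m [u [m1 u0 um ->]]]; rewrite lerBlDr -lerBlDl.
apply: lb_le_inf; first by exists (q z y).
move=> _ [n [v [n1 v0 vn ->]]]; rewrite lerBlDl; apply: ge_inf => //.
exists (m + n)%N, (fun i => if (i <= m)%N then u i else v (i - m)%N); split.
- by rewrite addn_gt0 m1.
- by [].
- by rewrite leqNgt -{1}(addn0 m) ltn_add2l n1 addKn.
rewrite [RHS](@big_cat_nat _ _ _ m) //= ?leq_addr //; congr (_ + _).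
  by apply: eq_big_nat => i /andP[_ im]; rewrite im ltnW.
rewrite -{1}(add0n m) (addnC m n) big_addn addnK; apply: eq_big_nat => i _.
have -> : (if (i + m <= m)%N then u (i + m)%N else v (i + m - m)%N) = v i.
  by rewrite addnK; case: i => [|i]; [rewrite add0n leqnn um v0|rewrite leqNgt addSn ltnS leq_addl].
by rewrite leqNgt ltnS leq_addl /= -addSn addnK.
Qed.

(** Hyperbolicity becomes q(x,y) <= e^{delta a} max(q(x,z), q(z,y)), to which [chain_le] applies
    because e^{2 delta a} <= 2. *)
Lemma gromov_metric_ge (delta : R) x y : 0 <= delta ->
  hyperbolic_with G delta -> expR (delta * a) < Num.sqrt 2 -> x <> y ->
  q x y <= 2 * theta x y.
Proof.
move=> d0 hyp lt2 xy.
rewrite -ler_pdivrMl // thetaE //; apply: lb_le_inf; first by exists (q x y).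
move=> _ [n [z [n1 <- <- ->]]]; rewrite ler_pdivrMl //.
apply: (@chain_le _ _ q (expR (delta * a))) => //.
- by rewrite -[leLHS]expR0 ler_expR mulr_ge0 // ltW.
- rewrite -[leRHS](@sqr_sqrtr _ 2) // ler_sqr ?nnegrE ?expR_ge0 ?sqrtr_ge0 //.
  exact: ltW.
move=> u v w; have := hyp u v w; rewrite lerBlDr ge_min => /orP[] h.
  apply: (@le_trans _ _ (expR (delta * a) * q u w)).
    by rewrite -expRD ler_expR; have := ler_wpM2l (ltW a0) h; lra.
  by rewrite ler_wpM2l ?expR_ge0 // le_max lexx.
apply: (@le_trans _ _ (expR (delta * a) * q w v)).
  by rewrite -expRD ler_expR; have := ler_wpM2l (ltW a0) h; lra.
by rewrite ler_wpM2l ?expR_ge0 // le_max lexx orbT.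
Qed.

End gromov_metric_theory.

(** * Completions *)

Section completion_theory.
Context {R : realType} {T : Type} (d : T -> T -> R).
Hypotheses (dxx : forall x, d x x = 0) (d_ge0 : forall x y, 0 <= d x y).
Hypotheses (d_sym : forall x y, d x y = d y x).
Hypothesis d_triangle : forall y x z, d x z <= d x y + d y z.
Implicit Types (u v w : nat -> T) (C D : completion d).

Let dist0 u v := d (u n) (v n) @[n --> \oo] --> (0 : R).

Let dist0_refl u : dist0 u u.
Proof. by rewrite /dist0; under eq_fun do rewrite dxx; exact: cvg_cst. Qed.

Let dist0_sym u v : dist0 u v -> dist0 v u.
Proof. by rewrite /dist0; under eq_fun do rewrite d_sym. Qed.

Let squeeze0 (f g : nat -> R) : (forall n, 0 <= f n <= g n) ->
  g @ \oo --> (0 : R) -> f @ \oo --> (0 : R).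
Proof.
by move=> fg g0; apply: (squeeze_cvgr _ (cvg_cst 0) g0); apply: nearW.
Qed.

Let dist0_trans v u w : dist0 u v -> dist0 v w -> dist0 u w.
Proof.
move=> uv vw; apply: (@squeeze0 _ (fun n => d (u n) (v n) + d (v n) (w n))).
  by move=> n; rewrite d_ge0 d_triangle.
by rewrite -[0 in X in _ --> X](addr0 0); exact: cvgD.
Qed.

Let dist_diff x y x' y' : `|d x y - d x' y'| <= d x x' + d y y'.
Proof.
have := d_triangle x' x y; have := d_triangle y' x' y.
have := d_triangle x x' y'; have := d_triangle y x y'.
rewrite (d_sym x' x) (d_sym y' y) ler_norml; lra.
Qed.

Lemma cauchy_dist_cvg u v : cauchy_sequence d u -> cauchy_sequence d v ->
  cvg (d (u n) (v n) @[n --> \oo]).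
Proof.
move=> cu cv; apply: cauchy_cvg; apply: cauchy_exP => e e0.
have e20 : 0 < e / 2 by rewrite divr_gt0.
have [N1 uN] := cu _ e20; have [N2 vN] := cv _ e20.
pose N := maxn N1 N2; exists (d (u N) (v N)).
exists N => // n /= Nn; rewrite /ball /=; apply: le_lt_trans (dist_diff _ _ _ _) _.
by rewrite (splitr e) ltrD ?uN ?vN //; rewrite ?leq_maxl ?leq_maxr //;
  apply: leq_trans Nn; rewrite ?leq_maxl ?leq_maxr.
Qed.

Let representativeP C : cauchy_sequence d (representative C) /\
  sval C = cauchy_class d (representative C).
Proof. by rewrite /representative; case: cid2. Qed.

Lemma completion_memP C v :
  sval C v <-> cauchy_sequence d v /\ dist0 (representative C) v.
Proof. by have [_ ->] := representativeP C. Qed.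

Lemma completion_eq u v C D : dist0 u v -> sval C u -> sval D v -> C = D.
Proof.
move=> uv /completion_memP[cu Cu] /completion_memP[cv Dv].
have CD : dist0 (representative C) (representative D).
  by apply: (dist0_trans Cu); apply: (dist0_trans uv); exact: dist0_sym.
suff E : sval C = sval D.
  by case: C D E {CD Cu Dv} => [C hC] [D hD] /= E; apply: eq_exist.
apply/seteqP; split => w /completion_memP[cw rw]; apply/completion_memP; split => //.
  exact: dist0_trans (dist0_sym CD) rw.
exact: dist0_trans CD rw.
Qed.

(** [completion_dist] is defined by chosen representatives; this frees it from that choice, so that
    rays can compute it. *)
Lemma completion_dist_cvg u v C D : sval C u -> sval D v ->
  d (u n) (v n) @[n --> \oo] --> completion_dist C D.
Proof.
move=> /completion_memP[cu Cu] /completion_memP[cv Dv].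
have [cC _] := representativeP C; have [cD _] := representativeP D.
have := cauchy_dist_cvg cC cD; rewrite /completion_dist.
set l := lim _ => hl; rewrite -[l]add0r.
have -> : (fun n => d (u n) (v n)) = (fun n =>
    (d (u n) (v n) - d (representative C n) (representative D n)) +
    d (representative C n) (representative D n)).
  by apply/funext => n; rewrite subrK.
apply: cvgD => //; apply/norm_cvg0P.
apply: (@squeeze0 _ (fun n => d (representative C n) (u n) + d (representative D n) (v n))).
  by move=> n; rewrite normr_ge0 distrC dist_diff.
by rewrite -[0 in X in _ --> X](addr0 0); exact: cvgD.
Qed.

Lemma completion_dist_unique u v C D l : sval C u -> sval D v ->
  d (u n) (v n) @[n --> \oo] --> l -> completion_dist C D = l.
Proof. by move=> Cu Dv; apply: (cvg_unique _ (completion_dist_cvg Cu Dv)). Qed.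

Lemma completion_distxx C : completion_dist C C = 0.
Proof.
have [cC _] := representativeP C.
have repC : sval C (representative C) by apply/completion_memP; split.
exact: (completion_dist_unique repC repC (dist0_refl _)).
Qed.

Lemma completion_embed_mem x : sval (completion_embed dxx x) (fun=> x).
Proof. by split; [exact: cauchy_sequence_cst|exact: (dist0_refl (fun=> x))]. Qed.

(** Turns convergence of a ray to a boundary point into membership in a class, which is easier to
    handle. *)
Lemma completion_embed_cvg u C : cauchy_sequence d u ->
  completion_dist (completion_embed dxx (u n)) C @[n --> \oo] --> (0 : R) <->
  sval C u.
Proof.
move=> cu; have [cC _] := representativeP C.
have repC : sval C (representative C) by apply/completion_memP; split.
split=> [uC|Cu].
  apply/completion_memP; split => //; apply/cvgrPdist_lt => e e0.
  have e20 : 0 < e / 2 by rewrite divr_gt0.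
  have [N CN] := cC _ e20.
  move/cvgrPdist_lt : uC => /(_ _ e20) uC; near=> n; rewrite sub0r normrN.
  have := completion_dist_cvg (completion_embed_mem (u n)) repC.
  have : `|0 - completion_dist (completion_embed dxx (u n)) C| < e / 2.
    by near: n.
  rewrite sub0r normrN => /(le_lt_trans (ler_norm _)) lt_e.
  move=> /cvgr_lt/(_ _ lt_e)[N' _ /= N'P].
  have um := N'P (maxn N N') (leq_maxr _ _).
  have nN : (N <= n)%N by near: n; exact: nbhs_infty_ge.
  have := CN n (maxn N N') nN (leq_maxl _ _).
  rewrite ger0_norm //.
  have := d_triangle (representative C (maxn N N')) (representative C n) (u n).
  rewrite (d_sym (representative C (maxn N N')) (u n)); lra.
apply/cvgrPdist_le => e e0; have [N uN] := cu _ e0.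
near=> n; rewrite sub0r normrN.
(* The distance from [u n] to [C] is the limit of d(u_n, u_m) as [m] grows. *)
have uncvg := completion_dist_cvg (completion_embed_mem (u n)) Cu.
have nN : (N <= n)%N by near: n; exact: nbhs_infty_ge.
have hd : \forall m \near \oo, 0 <= d (u n) (u m) <= e.
  by exists N => // m /= Nm; rewrite d_ge0 ltW // uN.
rewrite ger0_norm.
  by apply: (ler_cvg_to uncvg (cvg_cst e)); apply: filterS hd => m /andP[].
by apply: (ler_cvg_to (cvg_cst 0) uncvg); apply: filterS hd => m /andP[].
Unshelve. all: by end_near.
Qed.

End completion_theory.

(** * The induced map on the boundary *)

Lemma cvg_expRN {R : realType} (a : R) : 0 < a ->
  expR (- (a * n%:R)) @[n --> \oo] --> (0 : R).
Proof.
move=> a0; have -> : (fun n => expR (- (a * n%:R))) = (fun n => expR (- a) ^+ n).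
  by apply/funext => n; rewrite -expRM_natl mulrN mulrC.
apply: cvg_expr; rewrite ger0_norm ?expR_ge0 //.
by rewrite -expR0 ltr_expR oppr_lt0.
Qed.

Section boundary_map.
Context {R : realType} {M : metricType R} {X : countType}.
Variables (G : rooted_graph X) (Phi : X -> set M) (b : R).
Hypothesis G_vertical : vertical G.
Hypothesis Phi_index : is_index_map G Phi.
Hypothesis b0 : 0 < b.
Hypothesis Phi_exp : exponential_type G Phi b.
Variables (delta a : R).
Hypotheses (delta0 : 0 <= delta) (a0 : 0 < a).
Local Notation A := (AI_graph G Phi).
Hypothesis A_hyperbolic : hyperbolic_with A delta.
Hypothesis lt_sqrt2 : expR (delta * a) < Num.sqrt 2.

Local Notation gp := (gromov_product A : X -> X -> R).
Local Notation theta := (gromov_metric A a).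
Local Notation boundary := (boundary A a).

Let theta_xx := gromov_metricxx A a.
Let theta_ge0 := gromov_metric_ge0 A a.
Let theta_sym := gromov_metric_sym A a.
Let theta_triangle := gromov_metric_triangle A a.

Lemma height_ray r i : is_ray G r -> height G (r i) = i.
Proof.
move=> [rG rS]; elim: i => [|i IH]; first by rewrite rG height_root.
by have [-> _] := rS i; rewrite IH addn1.
Qed.

Lemma ray_sub r i j : is_ray G r -> (i <= j)%N -> Phi (r j) `<=` Phi (r i).
Proof.
have [_ _ Phi_desc _] := Phi_index.
move=> [_ rS]; elim: j => [|j IH]; first by rewrite leqn0 => /eqP ->.
rewrite leq_eqVlt => /orP[/eqP -> //|]; rewrite ltnS => /IH ij.
by apply: subset_trans ij; apply: Phi_desc.
Qed.

Lemma meet_theta x y k : Phi x `&` Phi y !=set0 ->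
  (k <= height G x)%N -> (k <= height G y)%N ->
  theta x y <= expR (a / 2) * expR (- (a * k%:R)).
Proof.
have [par parP] := parent_ex G.
move=> xy kx ky; apply: le_trans (gromov_metric_le _ _ _ _) _.
rewrite -expRD ler_expR.
have := ler_wpM2l (ltW a0) (meet_gromov parP Phi_index xy kx ky).
rewrite mulrBr; lra.
Qed.

Lemma meet_theta_small e : 0 < e -> exists N, forall x y,
  Phi x `&` Phi y !=set0 -> (N <= height G x)%N -> (N <= height G y)%N ->
  theta x y < e.
Proof.
move=> e0; have /cvgr_lt/(_ e e0)[N _ NP] :
    expR (a / 2) * expR (- (a * n%:R)) @[n --> \oo] --> (0 : R).
  by rewrite -(mulr0 (expR (a / 2))); apply: cvgMr; exact: cvg_expRN.
exists N => x y xy hx hy; apply: le_lt_trans (meet_theta xy hx hy) _.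
exact: (NP N (leqnn N)).
Qed.

(** The sets of two vertices of a ray meet, since one of them contains the other. *)
Lemma ray_cauchy r : is_ray G r -> cauchy_sequence theta r.
Proof.
move=> rr e /meet_theta_small[N NP]; exists N => m n Nm Nn.
apply: NP; rewrite ?height_ray //.
have [Phi0 _ _ _] := Phi_index.
have [p pr] := Phi0 (r (maxn m n)); exists p.
by split; apply: ray_sub p pr; rewrite ?leq_maxl ?leq_maxr.
Qed.

(** Vertices are isolated points, since Gromov products with [x] never exceed the height of [x]. *)
Lemma theta_isolated x y : x <> y -> expR (- (a * (height G x)%:R)) / 2 <= theta x y.
Proof.
move=> xy; rewrite ler_pdivrMr // [leRHS]mulrC.
apply: le_trans (gromov_metric_ge a0 delta0 A_hyperbolic lt_sqrt2 xy).
rewrite ler_expR lerN2 ler_pM2l // -(AI_height G Phi).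
exact: gromov_product_le_height.
Qed.

(** Otherwise [u] takes some value [x] infinitely often; as [u] is Cauchy and [x] isolated, [u] is
    eventually constant and its class is that of a vertex. *)
Lemma boundary_height (xi : boundary) u : sval (sval xi) u ->
  forall H, exists N, forall n, (N <= n)%N -> (H <= height G (u n))%N.
Proof.
move=> xiu H; apply: contrapT => /forallNP noN.
have fin : finite_set [set y | (height G y < H)%N].
  apply: (@sub_finite_set _ _ (\bigcup_(k in `I_H) level G k)).
    by move=> y /= yH; exists (height G y).
  by apply: bigcup_finite => // k _; exact: finite_level.
have [|x _ xinf] := @infinite_pigeonhole _ _ (fun=> True) u fin.
  move=> N; have /existsNP[n /not_implyP[Nn /negP]] := noN N.
  by rewrite -ltnNge => un; exists n.
have /completion_memP[cu _] := xiu.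
have e0 : 0 < expR (- (a * (height G x)%:R)) / 2 :> R by rewrite divr_gt0 ?expR_gt0.
have [N uN] := cu _ e0.
have [m Nm [_ um]] := xinf N.
apply: (proj2_sig xi x).
apply: (completion_eq theta_ge0 theta_sym theta_triangle _ xiu
  (completion_embed_mem theta_xx x)).
apply: cvg_near_cst.
exists N => // n /= Nn; have [->|/eqP unx] := eqVneq (u n) x; first exact: theta_xx.
have := uN m n Nm Nn; rewrite um.
by have := theta_isolated (nesym unx); rewrite leNgt => /negP.
Qed.

(** The ray from [koenig] shadows [u]: [r N] is an ancestor of some late [u m], so their sets meet
    and the two vertices are close. *)
Lemma boundary_ray (xi : boundary) : exists2 r, is_ray G r & sval (sval xi) r.
Proof.
have [par parP] := parent_ex G.
have [u cu Eu] := svalP (sval xi).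
have xiu : sval (sval xi) u.
  rewrite Eu; split => //.
  have -> : (fun n => theta (u n) (u n)) = (fun=> 0) by apply/funext => n; exact: theta_xx.
  exact: cvg_cst.
have [r rr rP] := koenig parP (boundary_height xiu).
exists r => //; have cr := ray_cauchy rr; rewrite Eu; split => //.
apply/cvgrPdist_lt => e e0; have e30 : 0 < e / 3 by rewrite divr_gt0.
have [N1 N1P] := cu _ e30; have [N2 N2P] := cr _ e30.
have [N3 N3P] := meet_theta_small e30.
pose N := maxn N1 (maxn N2 N3); exists N => // n /= Nn.
have N1N : (N1 <= N)%N by rewrite leq_maxl.
have N2N : (N2 <= N)%N by rewrite leq_max leq_maxl orbT.
have N3N : (N3 <= N)%N by rewrite !leq_max leqnn !orbT.
have [m Nm [hm rm]] := rP N N.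
have ur : theta (u m) (r N) < e / 3.
  apply: N3P; rewrite ?(height_ray _ rr) //; last exact: leq_trans N3N hm.
  have [Phi0 _ _ _] := Phi_index.
  have [p pu] := Phi0 (u m); exists p; split => //.
  by rewrite -rm; exact: Phi_ancestor pu.
rewrite sub0r normrN ger0_norm //.
have uu := N1P n m (leq_trans N1N Nn) (leq_trans N1N Nm).
have rr' := N2P N n N2N (leq_trans N2N Nn).
have := theta_triangle (u m) (u n) (r n); have := theta_triangle (r N) (u m) (r n).
lra.
Qed.

(** A ray leaves every vertex and vertices are isolated, so its class is not that of a vertex. *)
Lemma ray_boundary r : is_ray G r -> exists xi : boundary, sval (sval xi) r.
Proof.
move=> rr; have cr := ray_cauchy rr.
pose C : completion theta := exist _ (cauchy_class theta r) (ex_intro2 _ _ r cr erefl).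
have Cr : sval C r.
  split => //.
  have -> : (fun n => theta (r n) (r n)) = (fun=> 0) by apply/funext => n; exact: theta_xx.
  exact: cvg_cst.
suff Cx x : C <> gromov_embed A a x by exists (exist _ C Cx).
move=> CE; have : sval C (fun=> x).
  by rewrite CE; exact: (completion_embed_mem theta_xx x).
case=> _ /cvgr_lt/(_ (expR (- (a * (height G x)%:R)) / 2)).
rewrite divr_gt0 ?expR_gt0 // => /(_ isT)[N _ NP].
pose n := maxn N (height G x).+1.
have := NP n (leq_maxl _ _); rewrite /= theta_sym.
have xr : x <> r n.
  move=> /(congr1 (height G)); rewrite height_ray // /n.
  by move: (height G x) => h; lia.
by have := theta_isolated xr; rewrite leNgt => /negP.
Qed.

(** The exponent [a / b] turns e^{-b(x|y)} into e^{-a(x|y)}, which is at most twice [theta] at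
    distinct vertices; the estimate along two rays then passes to the limit. *)
Lemma boundary_mdist : exists2 C : R, 0 < C & forall (xi eta : boundary) r s p q,
  is_ray G r -> is_ray G s -> sval (sval xi) r -> sval (sval eta) s ->
  (forall i, Phi (r i) p) -> (forall i, Phi (s i) q) ->
  mdist p q `^ (a / b) <= C * boundary_dist xi eta.
Proof.
have [B B0 BP] := mdist_gromov G_vertical Phi_index b0 Phi_exp.
have ab0 : 0 < a / b by rewrite divr_gt0.
exists (B `^ (a / b) * 2); first by rewrite mulr_gt0 // powR_gt0.
move=> xi eta r s p q rr ss xir etas rp sq.
(* The last term covers the case [r i = s i], where [theta] vanishes while the Gromov product is
   only [i]; it tends to 0. *)
have step i : mdist p q `^ (a / b) <=
    B `^ (a / b) * (2 * theta (r i) (s i) + expR (- (a * i%:R))).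
  apply: (@le_trans _ _ ((B * expR (- (b * gp (r i) (s i)))) `^ (a / b))).
    apply: ge0_ler_powR; last exact: BP.
    - exact: ltW.
    - exact: mdist_ge0.
    - by rewrite nnegrE mulr_ge0 ?expR_ge0 ?(ltW B0).
  rewrite powRM ?expR_ge0 ?(ltW B0) // ler_wpM2l ?powR_ge0 // -expRM.
  have -> : - (b * gp (r i) (s i)) * (a / b) = - (a * gp (r i) (s i)).
    by field; rewrite gt_eqF.
  have [rs|/eqP rs] := eqVneq (r i) (s i).
    rewrite rs theta_xx mulr0 add0r /gromov_product gdistxx subr0 AI_height height_ray //.
    by rewrite mulrDl -splitr.
  have := gromov_metric_ge a0 delta0 A_hyperbolic lt_sqrt2 rs.
  by have := expR_ge0 (- (a * i%:R)); lra.
have rhs_cvg : B `^ (a / b) * (2 * theta (r i) (s i) + expR (- (a * i%:R)))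
    @[i --> \oo] --> B `^ (a / b) * (2 * boundary_dist xi eta + 0).
  apply: cvgMr; apply: cvgD; last exact: cvg_expRN.
  by apply: cvgMr; exact: completion_dist_cvg xir etas.
rewrite -mulrA -[2 * boundary_dist _ _]addr0.
by apply: (ler_cvg_to (cvg_cst _) rhs_cvg); exact: nearW.
Qed.

Lemma induced_map_exists : exists kappa : boundary -> M,
  [/\ induced_map kappa,
      set_bij [set: boundary] (attractor G Phi) kappa &
      exists2 C : R, 0 < C & forall xi eta : boundary,
        mdist (kappa xi) (kappa eta) `^ (a / b) <= C * boundary_dist xi eta].
Proof.
have [par parP] := parent_ex G.
have [_ _ _ Phi_ray] := Phi_index.
have [C C0 CP] := boundary_mdist.
have ab0 : a / b != 0 by rewrite gt_eqF // divr_gt0.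
have embP (xi : boundary) r : is_ray G r -> converges_to_boundary r xi <-> sval (sval xi) r.
  by move=> /ray_cauchy cr; exact: completion_embed_cvg.
have bdxx (xi : boundary) : boundary_dist xi xi = 0 by exact: completion_distxx.
have limP (r : nat -> X) p : \bigcap_i Phi (r i) = [set p] -> forall i, Phi (r i) p.
  move=> rp i; have : (\bigcap_i Phi (r i)) p by rewrite rp.
  exact.
(* The Hoelder bound with both boundary points equal shows that the limit point does not depend on
   the ray. *)
have uniq_lim (xi : boundary) r s p q : is_ray G r -> is_ray G s ->
    sval (sval xi) r -> sval (sval xi) s ->
    (forall i, Phi (r i) p) -> (forall i, Phi (s i) q) -> p = q.
  move=> rr ss xir xis rp sq; apply: mdist_positivity; apply/eqP.
  have := CP xi xi r s p q rr ss xir xis rp sq; rewrite bdxx mulr0 => le0.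
  have : mdist p q `^ (a / b) == 0 by rewrite eq_le le0 powR_ge0.
  by rewrite powR_eq0 ab0 andbT.
have /choice[kappa kP] : forall xi : boundary, exists p, exists r,
    [/\ is_ray G r, sval (sval xi) r & \bigcap_i Phi (r i) = [set p]].
  move=> xi; have [r rr xir] := boundary_ray xi.
  by have [p pP] := Phi_ray r rr; exists p, r.
exists kappa; split.
- split=> [xi|xi r rr /embP xir].
    by have [r [rr xir _]] := kP xi; exists r => //; exact/embP.
  have [s [ss xis sP]] := kP xi; have [p pP] := Phi_ray r rr.
  rewrite pP; congr [set _].
  exact: (uniq_lim xi r s _ _ rr ss (xir rr) xis (limP _ _ pP) (limP _ _ sP)).
- split.
  + move=> xi _; have [r [rr xir rP]] := kP xi => n _.
    by exists (r n); [rewrite /level /= height_ray|exact: limP _ _ rP n].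
  (* Injectivity: the common image lies in both [Phi (r n)] and [Phi (s n)], so theta(r_n, s_n)
     tends to 0. *)
  + move=> xi eta _ _ E.
    have [r [rr xir rP]] := kP xi; have [s [ss etas sP]] := kP eta.
    apply/eq_sig_hprop => /=; first by move=> c h1 h2; exact: Prop_irrelevance.
    apply: (completion_eq theta_ge0 theta_sym theta_triangle _ xir etas).
    apply/cvgrPdist_lt => e /meet_theta_small[N NP].
    exists N => // n /= Nn; rewrite sub0r normrN ger0_norm //.
    apply: NP; rewrite ?height_ray //; exists (kappa xi).
    by split; [exact: limP _ _ rP n|rewrite E; exact: limP _ _ sP n].
  (* Surjectivity: [p] lies in the set of some vertex at each level, hence in the sets of all their
     ancestors and so along the whole ray that [koenig] extracts. *)
  + move=> p Kp; have /choice[u uP] : forall n, exists x, level G n x /\ Phi x p.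
      by move=> n; have [x xn xp] := Kp n I; exists x.
    have [|r rr rP] := koenig parP (u := u).
      by move=> H; exists H => n; have [-> _] := uP n.
    have rp i : Phi (r i) p.
      have [n _ [hn <-]] := rP i 0%N.
      by apply: Phi_ancestor hn _ _ => //; have [] := uP n.
    have [xi xir] := ray_boundary rr; exists xi => //.
    have [s [ss xis sP]] := kP xi.
    exact: (uniq_lim xi s r _ _ ss rr xis xir (limP _ _ sP) rp).
- exists C => // xi eta.
  have [r [rr xir rP]] := kP xi; have [s [ss etas sP]] := kP eta.
  exact: CP rr ss xir etas (limP _ _ rP) (limP _ _ sP).
Qed.

End boundary_map.

Theorem theorem1p4 (R : realType) (M : metricType R) (X : countType)
    (G : rooted_graph X) (Phi : X -> set M) (b : R) :
  complete_space M ->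
  vertical G ->
  (forall x, descendants G 1 x !=set0) ->
  is_index_map G Phi ->
  0 < b ->
  exponential_type G Phi b ->
  separation_condition G Phi b ->
  hyperbolic R (AI_graph G Phi) /\
  forall delta a : R,
    0 <= delta -> hyperbolic_with (AI_graph G Phi) delta ->
    0 < a -> expR (delta * a) < Num.sqrt 2 ->
    exists kappa : boundary (AI_graph G Phi) a -> M,
      [/\ induced_map kappa,
          set_bij [set: boundary (AI_graph G Phi) a] (attractor G Phi) kappa &
          exists2 C : R, 0 < C & forall xi eta : boundary (AI_graph G Phi) a,
            mdist (kappa xi) (kappa eta) `^ (a / b) <= C * boundary_dist xi eta].
Proof.
move=> _ G_vertical G_children Phi_index b0 Phi_exp sep.
split; first exact: (AI_hyperbolic G_vertical G_children Phi_index b0 Phi_exp sep).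
move=> delta a delta0 A_hyperbolic a0 lt_sqrt2.
exact: (induced_map_exists G_vertical Phi_index b0 Phi_exp delta0 a0 A_hyperbolic).
Qed.
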